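(* For a $1$-reduced simplicial set $X$, the diagonal on the cobar construction $\Omega\,C(X)$ induced by the homotopy Gerstenhaber coalgebra structure of $C(X)$, that is, the multiplicative extension of $$\Delta\langle x\rangle=\langle x\rangle\otimes1+\sum_{k=0}^n\sum_{\mathbf p}(-1)^{\epsilon(\mathbf p)}\langle x_1^{\mathbf p}|\dots|x_k^{\mathbf p}\rangle\otimes\langle x_{k+1}^{\mathbf p}\rangle,\qquad x\in X_n,$$ is the same as Baues' diagonal.
   Context: **Conventions.** $\Bbbk$ is a commutative ring with unit, $C(X)$ the normalized chains on $X$ over $\Bbbk$; the Koszul sign rule is used. $X$ is $1$-reduced: it has exactly one $0$-simplex $x_0$ and no non-degenerate $1$-simplex. $\Omega\,C(X)=\bigoplus_{k\ge0}(\mathbf s^{-1}\bar C)^{\otimes k}$, $\bar C=\ker(\epsilon\colon C(X)\to\Bbbk)$, with elements $\langle c_1|\dots|c_k\rangle=\mathbf s^{-1}c_1\otimes\dots\otimes\mathbf s^{-1}c_k$ and concatenation product. For $x\in X_n$ and a weakly increasing sequence $v_0\le\dots\le v_m$ in $\{0,\dots,n\}$, $x(v_0,\dots,v_m)\in X_m$ is the image of $x$ under the simplicial operator corresponding to $i\mapsto v_i$; degenerate simplices are $0$ in $C(X)$. **First diagonal.** $\mathbf p$ runs over all sequences $0=p_0\le p_1\le\dots\le p_{2k+1}=n$; $x^{\mathbf p}_s=x(p_{2s-1},p_{2s-1}+1,\dots,p_{2s})$ for $1\le s\le k$; $x^{\mathbf p}_{k+1}=x(p_0,\dots,p_1,p_2,\dots,p_3,\dots,p_{2k},\dots,p_{2k+1})$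 (concatenation of the intervals $[p_{2i},p_{2i+1}]$, $0\le i\le k$); and $$\epsilon(\mathbf p)=\tfrac{k(k-1)}2+\sum_{s=1}^k(k+1-s)(p_{2s}-p_{2s-1})+\sum_{s=1}^kp_{2s-1}+\sum_{s=1}^k(p_{2s}-p_{2s-1})\sum_{i=0}^{s-1}(p_{2i+1}-p_{2i}+1).$$ **Baues' diagonal.** It is the multiplicative extension of $$\Delta\langle x\rangle=\sum_{b\subset\{1,\dots,n-1\}}(-1)^{(b^c,b)}\,\langle x(0,\dots,b_1)\,|\,x(b_1,\dots,b_2)\,|\cdots|\,x(b_r,\dots,n)\rangle\otimes\langle x(0,b_1,\dots,b_r,n)\rangle$$ for $x\in X_n$, $n\ge2$, where $b=\{b_1<\dots<b_r\}$, $x(b_i,\dots,b_{i+1})$ is the face spanned by all vertices from $b_i$ to $b_{i+1}$, $(-1)^{(b^c,b)}$ is the sign of the shuffle $(\{1,\dots,n-1\}\setminus b,\,b)$ (the permutation listing the elements of the complement in increasing order, followed by those of $b$ in increasing order), and with the convention that each entry which is a face on exactly two vertices (a $1$-dimensional face of $x$) is omitted, i.e. such $\langle\cdot\rangle$ is replaced by the unit $1$. *)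

(* Defs.v *)
From HB Require Import structures.
From mathcomp Require Import all_boot all_order all_fingroup all_algebra.
From mathcomp Require Import finmap boolp.
From mathcomp Require Import monalg.

Set Implicit Arguments.
Unset Strict Implicit.
Unset Printing Implicit Defensive.

Import GRing.Theory.

Local Open Scope ring_scope.

(* Morphisms [m] -> [n] of the simplex category. *)
Definition is_monotone (m n : nat) (f : {ffun 'I_m.+1 -> 'I_n.+1}) : bool :=
  [forall i : 'I_m.+1, forall j : 'I_m.+1, (i <= j)%N ==> (f i <= f j)%N].

Definition simp_op (m n : nat) := {f : {ffun 'I_m.+1 -> 'I_n.+1} | is_monotone f}.

Lemma simp_op_id_subproof n : is_monotone [ffun i : 'I_n.+1 => i].
Proof. by apply/forallP=> i; apply/forallP=> j; apply/implyP; rewrite !ffunE. Qed.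

Definition simp_op_id n : simp_op n n := Sub _ (simp_op_id_subproof n).

Lemma simp_op_comp_subproof l m n (g : simp_op m n) (f : simp_op l m) :
  is_monotone [ffun i => val g (val f i)].
Proof.
apply/forallP=> i; apply/forallP=> j; apply/implyP=> le_ij; rewrite !ffunE.
have /forallP/(_ i)/forallP/(_ j)/implyP/(_ le_ij) le_f := valP f.
by have /forallP/(_ (val f i))/forallP/(_ (val f j))/implyP/(_ le_f) := valP g.
Qed.

Definition simp_op_comp l m n (g : simp_op m n) (f : simp_op l m) : simp_op l n :=
  Sub _ (simp_op_comp_subproof g f).

Record sset := SSet {
  simplices :> nat -> choiceType;
  sact : forall m n, simp_op m n -> simplices n -> simplices m;
  sact_id : forall n (x : simplices n), sact (simp_op_id n) x = x;
  sact_comp : forall l m n (g : simp_op m n) (f : simp_op l m) (x : simplices n),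
    sact (simp_op_comp g f) x = sact f (sact g x)
}.

Lemma simp_op_cst_subproof m n : is_monotone [ffun _ : 'I_m.+1 => @ord0 n].
Proof. by apply/forallP=> i; apply/forallP=> j; apply/implyP; rewrite !ffunE. Qed.

(* The operator i |-> v i. It has a junk value (a constant operator) unless v *)
(* is weakly increasing with values in {0, ..., n}; see vertex_opE.           *)
Definition vertex_op (m n : nat) (v : nat -> nat) : simp_op m n :=
  insubd (Sub _ (simp_op_cst_subproof m n) : simp_op m n)
    [ffun i : 'I_m.+1 => inord (v i)].

Lemma vertex_opE m n (v : nat -> nat) (i : 'I_m.+1) :
    (forall a b, (a <= b <= m)%N -> (v a <= v b)%N) ->
    (forall a, (a <= m)%N -> (v a <= n)%N) ->
  val (vertex_op m n v) i = v i :> nat.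
Proof.
move=> v_le v_n; rewrite val_insubd ifT.
  by rewrite ffunE inordK // ltnS v_n // -ltnS.
apply/forallP=> a; apply/forallP=> b; apply/implyP=> le_ab; rewrite !ffunE.
have le_bm : (b <= m)%N by rewrite -ltnS.
have le_am := leq_trans le_ab le_bm.
by rewrite !inordK ?ltnS ?v_n // v_le // le_ab.
Qed.

(* x(v_0, ..., v_m) for a nonempty sequence v *)
Definition face (X : sset) (n : nat) (x : X n) (v : seq nat) : X (size v).-1 :=
  sact (vertex_op (size v).-1 n (nth 0%N v)) x.

(* unbump i sends j to j if j <= i, and to j - 1 otherwise. *)
Definition degeneracy (X : sset) (n : nat) (i : 'I_n.+1) (y : X n) : X n.+1 :=
  sact (vertex_op n.+1 n (unbump i)) y.

Definition degenerate (X : sset) (n : nat) : X n -> bool :=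
  match n return X n -> bool with
  | 0 => fun _ => false
  | m.+1 => fun x => `[< exists (i : 'I_m.+1) (y : X m), x = degeneracy i y >]
  end.

Definition reduced (X : sset) : Prop := exists x0 : X 0%N, forall x : X 0%N, x = x0.

Definition one_reduced (X : sset) : Prop :=
  reduced X /\ (forall x : X 1%N, degenerate x).

Section LinearExtension.
Variables (k : comNzRingType) (K : choiceType) (V : lmodType k).

Definition linext (f : K -> V) (a : {malg k[K]}) : V :=
  \sum_(i <- msupp a) a@_i *: f i.

Lemma linextEw (f : K -> V) (d : {fset K}) a : (msupp a `<=` d)%fset ->
  linext f a = \sum_(i <- d) a@_i *: f i.
Proof.
move=> le_d; rewrite /linext; apply: big_fset_incl => // i _ /mcoeff_outdom ->.
by rewrite scale0r.
Qed.

Lemma linext_is_linear f : linear (linext f).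
Proof.
move=> c a b; pose d := (msupp a `|` msupp b)%fset.
have ab_d : (msupp (c *: a + b) `<=` d)%fset.
  apply: fsubset_trans (msuppD_le _ _) _.
  by apply: fsetUSS => //; apply: msuppZ_le.
rewrite (linextEw _ ab_d) (@linextEw f d a) ?fsubsetUl //.
rewrite (@linextEw f d b) ?fsubsetUr // scaler_sumr -big_split /=.
by apply: eq_bigr => i _; rewrite mcoeffD mcoeffZ scalerDl scalerA.
Qed.

HB.instance Definition _ f :=
  GRing.isLinear.Build k {malg k[K]} V *:%R (linext f) (linext_is_linear f).

Lemma linextU f i : linext f << i >> = f i.
Proof.
rewrite (linextEw f (d := [fset i]%fset)) ?msuppU_le //.
by rewrite big_seq_fset1 mcoeffUU scale1r.
Qed.

Lemma linextD_fun (f g : K -> V) a :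
  linext (fun i => f i + g i) a = linext f a + linext g a.
Proof. by rewrite /linext -big_split /=; apply: eq_bigr => i _; rewrite scalerDr. Qed.

Lemma linextZ_fun c (f : K -> V) a : linext (fun i => c *: f i) a = c *: linext f a.
Proof.
rewrite /linext scaler_sumr; apply: eq_bigr => i _.
by rewrite !scalerA [c * _]mulrC.
Qed.

End LinearExtension.

Lemma malgUZ (k : comNzRingType) (K : choiceType) c i :
  << c *g i >> = c *: << i >> :> {malg k[K]}.
Proof. by apply/malgP=> j; rewrite mcoeffZ !mcoeffU mulr_natr. Qed.

Lemma malgZr (k : comNzRingType) (M : monomType) c (a b : {malg k[M]}) :
  a * (c *: b) = c *: (a * b).
Proof.
rewrite (malgMEw (fsubset_refl _) (msuppZ_le c b)) malgME scaler_sumr.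
apply: eq_bigr => i _; rewrite scaler_sumr; apply: eq_bigr => j _.
by rewrite mcoeffZ mulrCA malgUZ [in RHS]malgUZ scalerA.
Qed.

Lemma malg_linear_ind (k : comNzRingType) (K : choiceType) (P : {malg k[K]} -> Prop) :
    P 0 -> (forall i, P << i >>) -> (forall c a b, P a -> P b -> P (c *: a + b)) ->
  forall a, P a.
Proof.
move=> P0 PU Plin a; rewrite [a]monalgE; elim/big_rec: _ => // i b _ Pb.
by rewrite malgUZ; apply: Plin.
Qed.

Section Bilinear.
Variables (k : comNzRingType) (V : lmodType k) (I : Type) (w : I -> V).
Variable (m : V -> V -> V).
Hypothesis w_ind : forall P : V -> Prop, P 0 -> (forall i, P (w i)) ->
  (forall c a b, P a -> P b -> P (c *: a + b)) -> forall a, P a.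
Hypothesis mPl : forall c a b d, m (c *: a + b) d = c *: m a d + m b d.
Hypothesis mPr : forall c a b d, m d (c *: a + b) = c *: m d a + m d b.

Lemma bil0l d : m 0 d = 0.
Proof. by have := mPl (-1) 0 0 d; rewrite scaler0 addr0 scaleN1r addNr. Qed.

Lemma bil0r d : m d 0 = 0.
Proof. by have := mPr (-1) 0 0 d; rewrite scaler0 addr0 scaleN1r addNr. Qed.

Lemma bilZl c a d : m (c *: a) d = c *: m a d.
Proof. by rewrite -[c *: a]addr0 mPl bil0l addr0. Qed.

Lemma bilZr c a d : m d (c *: a) = c *: m d a.
Proof. by rewrite -[c *: a]addr0 mPr bil0r addr0. Qed.

Lemma bilDl : left_distributive m +%R.
Proof. by move=> a b d; have := mPl 1 a b d; rewrite !scale1r. Qed.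

Lemma bilDr : right_distributive m +%R.
Proof. by move=> d a b; have := mPr 1 a b d; rewrite !scale1r. Qed.

Lemma bilA : (forall i j l, m (w i) (m (w j) (w l)) = m (m (w i) (w j)) (w l)) ->
  associative m.
Proof.
move=> wA a b d.
elim/w_ind: a => [|i|c a a' IH IH']; [by rewrite !bil0l| |by rewrite !mPl IH IH'].
elim/w_ind: b => [|j|c b b' IH IH'].
- by rewrite bil0l bil0r bil0l.
- elim/w_ind: d => [|l|c d d' IH IH']; [by rewrite !bil0r|exact: wA|].
  by rewrite !mPr IH IH'.
by rewrite mPl !mPr mPl IH IH'.
Qed.

Lemma bil_id1 e : (forall i, m e (w i) = w i) -> left_id e m.
Proof.
move=> we a; elim/w_ind: a => [|i|c a a' IH IH']; [exact: bil0r|exact: we|].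
by rewrite mPr IH IH'.
Qed.

Lemma bil_id2 e : (forall i, m (w i) e = w i) -> right_id e m.
Proof.
move=> we a; elim/w_ind: a => [|i|c a a' IH IH']; [exact: bil0l|exact: we|].
by rewrite mPl IH IH'.
Qed.

End Bilinear.

Section WordDegree.
Variables (B : choiceType) (deg : B -> nat).

Definition word_degree (w : {fmonom B}) : nat := (\sum_(e <- (w : seq B)) deg e)%N.

Lemma word_degreeM (v w : {fmonom B}) :
  word_degree (mmul v w) = (word_degree v + word_degree w)%N.
Proof. by rewrite /word_degree fmM big_cat. Qed.

Lemma word_degree1 : word_degree mone = 0%N.
Proof. by rewrite /word_degree fm1 big_nil. Qed.

End WordDegree.

(* The tensor square of the free algebra on B (with the generator e in degree *)
(* deg e); the degrees enter through the product mul2 below.                  *)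
Definition free2 (k : comNzRingType) (B : choiceType) (_ : B -> nat) : Type :=
  {malg k[({fmonom B} * {fmonom B})%type]}.

HB.instance Definition _ k (B : choiceType) (deg : B -> nat) :=
  GRing.Lmodule.on (free2 k deg).

HB.lock Definition word2 (k : comNzRingType) (B : choiceType) (deg : B -> nat)
  (v w : {fmonom B}) : free2 k deg := << (v, w) >>.

Arguments word2 {k B deg} v w.

HB.lock Definition tens (k : comNzRingType) (B : choiceType) (deg : B -> nat)
    (a b : {malg k[{fmonom B}]}) : free2 k deg :=
  linext (fun v => linext (fun w => word2 v w) b) a.

Arguments tens {k B deg} a b.

(* (v (x) w) (v' (x) w') = (-1) ^ (|w| |v'|) vv' (x) ww' *)
HB.lock Definition mul2 (k : comNzRingType) (B : choiceType) (deg : B -> nat)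
    (a b : free2 k deg) : free2 k deg :=
  linext (fun u => linext (fun v =>
    (-1) ^+ (word_degree deg u.2 * word_degree deg v.1) *:
      word2 (mmul u.1 v.1) (mmul u.2 v.2)) (b : {malg k[_]})) (a : {malg k[_]}).

Arguments mul2 {k B deg} a b.

Section FreeAlgebra.
Variables (k : comNzRingType) (B : choiceType) (deg : B -> nat).

Local Notation T2 := (free2 k deg).
Local Notation word_degree := (word_degree deg).

Definition one2 : T2 := word2 mone mone.

Lemma word2_neq0 v w : word2 v w != 0 :> T2.
Proof. by rewrite word2.unlock monalgU_eq0 oner_eq0. Qed.

Lemma mul2DlZ c a b (d : T2) : mul2 (c *: a + b) d = c *: mul2 a d + mul2 b d.
Proof. by rewrite mul2.unlock linearP. Qed.

Lemma mul2DrZ c a b (d : T2) : mul2 d (c *: a + b) = c *: mul2 d a + mul2 d b.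
Proof.
rewrite mul2.unlock -linextZ_fun -linextD_fun /linext; apply: eq_bigr => u _.
congr (_ *: _); exact: (linext_is_linear _ c a b).
Qed.

Lemma mul2_word u1 u2 v1 v2 :
  mul2 (word2 u1 u2) (word2 v1 v2 : T2) =
    (-1) ^+ (word_degree u2 * word_degree v1) *: word2 (mmul u1 v1) (mmul u2 v2).
Proof.
have wE x y : word2 x y = << (x, y) >> :> T2 by rewrite word2.unlock.
rewrite mul2.unlock (wE u1 u2) (wE v1 v2).
rewrite linextU.
by rewrite linextU.
Qed.

Let word2_ind (P : T2 -> Prop) : P 0 ->
    (forall vw, P (word2 vw.1 vw.2)) ->
    (forall c a b, P a -> P b -> P (c *: a + b)) ->
  forall a, P a.
Proof.
move=> P0 Pw Plin; apply: malg_linear_ind P0 _ Plin => -[v w].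
by have := Pw (v, w); rewrite word2.unlock.
Qed.

Lemma mul2Zl c a (d : T2) : mul2 (c *: a) d = c *: mul2 a d.
Proof. exact: bilZl mul2DlZ _ _ _. Qed.

Lemma mul2Zr c a (d : T2) : mul2 d (c *: a) = c *: mul2 d a.
Proof. exact: bilZr mul2DrZ _ _ _. Qed.

Lemma mul2A : associative (@mul2 k B deg).
Proof.
apply: (bilA word2_ind mul2DlZ mul2DrZ) => -[a1 a2] [b1 b2] [d1 d2] /=.
rewrite (mul2_word b1 b2) (mul2_word a1 a2) mul2Zl mul2Zr.
rewrite (mul2_word a1 a2) (mul2_word (mmul a1 b1)).
rewrite !scalerA -!exprD (mulmA a1) (mulmA a2) !word_degreeM mulnDl mulnDr.
by rewrite [(word_degree b2 * _ + _)%N]addnC -addnA.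
Qed.

Lemma mul12 : left_id one2 (@mul2 k B deg).
Proof.
apply: (bil_id1 word2_ind mul2DrZ) => -[v w] /=.
by rewrite mul2_word word_degree1 scale1r (mul1m v) (mul1m w).
Qed.

Lemma mul21 : right_id one2 (@mul2 k B deg).
Proof.
apply: (bil_id2 word2_ind mul2DlZ) => -[v w] /=.
by rewrite mul2_word word_degree1 muln0 scale1r (mulm1 v) (mulm1 w).
Qed.

Lemma mul2Dl : left_distributive (@mul2 k B deg) +%R.
Proof. exact: bilDl mul2DlZ. Qed.

Lemma mul2Dr : right_distributive (@mul2 k B deg) +%R.
Proof. exact: bilDr mul2DrZ. Qed.

HB.instance Definition _ := GRing.Zmodule_isNzRing.Build (free2 k deg)
  mul2A mul12 mul21 mul2Dl mul2Dr (word2_neq0 mone mone).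

HB.instance Definition _ := GRing.Lmodule_isLalgebra.Build k (free2 k deg)
  (fun c a b => esym (mul2Zl c a b)).

HB.instance Definition _ := GRing.Lalgebra_isAlgebra.Build k (free2 k deg)
  (fun c a b => esym (mul2Zr c b a)).

Lemma tens_word u v : tens << u >> << v >> = word2 u v :> T2.
Proof. by rewrite tens.unlock linextU linextU. Qed.

Lemma tens_mul u1 u2 v1 v2 :
  tens << u1 >> << u2 >> * tens << v1 >> << v2 >> =
    (-1) ^+ (word_degree u2 * word_degree v1) *:
      tens << mmul u1 v1 >> << mmul u2 v2 >> :> T2.
Proof.
rewrite (tens_word u1) (tens_word v1) (tens_word (mmul _ _)).
exact: mul2_word.
Qed.

End FreeAlgebra.

Lemma linear_multiplicative (k : comNzRingType) (A : lalgType k) (S : algType k)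
    (I : Type) (w : I -> A) (op : I -> I -> I) (m : A -> S) :
    (forall P : A -> Prop, P 0 -> (forall i, P (w i)) ->
      (forall c a b, P a -> P b -> P (c *: a + b)) -> forall a, P a) ->
    (forall c (a b : A), a * (c *: b) = c *: (a * b)) ->
    (forall i j, w i * w j = w (op i j)) ->
    m 0 = 0 -> (forall c a b, m (c *: a + b) = c *: m a + m b) ->
    (forall i j, m (w (op i j)) = m (w i) * m (w j)) ->
  forall a b, m (a * b) = m a * m b.
Proof.
move=> w_ind AZr wM m0 mP mM a b.
elim/w_ind: a => [|i|c x y IHx IHy]; first by rewrite mul0r m0 mul0r.
  elim/w_ind: b => [|j|c x y IHx IHy]; first by rewrite mulr0 m0 mulr0.
    by rewrite wM mM.
  by rewrite mulrDr AZr !mP IHx IHy mulrDr -scalerAr.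
by rewrite mulrDl -scalerAl !mP IHx IHy mulrDl -scalerAl.
Qed.

Section MultiplicativeExtension.
Variables (k : comNzRingType) (B : choiceType) (S : algType k).

(* the multiplicative extension of f *)
Definition multext (f : B -> S) (a : {malg k[{fmonom B}]}) : S :=
  linext (fun w : {fmonom B} => \prod_(e <- (w : seq B)) f e) a.

Lemma multext_gen f e : multext f << fmu e >> = f e.
Proof. by rewrite /multext linextU fmuE /= big_seq1. Qed.

Lemma multext_is_linear f : linear (multext f).
Proof. exact: linext_is_linear. Qed.

Lemma multext1 f : multext f 1 = 1.
Proof. by rewrite /multext linextU fm1 big_nil. Qed.

Lemma multextM f a b : multext f (a * b) = multext f a * multext f b.
Proof.
apply: (linear_multiplicative (w := fun v => << v >>) (op := mmul)).
- exact: malg_linear_ind.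
- exact: malgZr.
- by move=> v w; rewrite malgM_def fgmulUU mulr1.
- by rewrite /multext linear0.
- exact: multext_is_linear.
- by move=> v w; rewrite /multext linextU linextU linextU fmM big_cat.
Qed.

End MultiplicativeExtension.

Section NormalizedChains.
Variables (k : comNzRingType) (X : sset).

Definition nondeg : choiceType := {n : nat & {x : X n | ~~ degenerate x}}.

Definition dim (s : nondeg) : nat := tag s.

(* Normalized chains: the free module on the nondegenerate simplices. *)
Definition chains : lmodType k := {malg k[nondeg]}.

Definition chain (n : nat) (x : X n) : chains :=
  if insub x is Some y then << Tagged (fun n => {x : X n | ~~ degenerate x}) y >> else 0.

Definition aug (c : chains) : k^o := linext (fun s => (dim s == 0%N)%:R) c.

(* For X reduced, ker aug is free on the nondegenerate simplices of positive *)
(* dimension, see aug_eq0.                                                   *)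
Definition cell : choiceType := {s : nondeg | (0 < dim s)%N}.

Lemma aug_eq0 (c : chains) : reduced X ->
  aug c = 0 <-> {in msupp c, forall s, (0 < dim s)%N}.
Proof.
case=> x0 x0P; split=> [|c_pos]; last first.
  by rewrite /aug /linext big_seq big1 // => s /c_pos; case: (dim s) => // n; rewrite scaler0.
move=> aug0 s s_c; rewrite lt0n; apply/negP=> /eqP s0.
have eq_s t : dim t = 0 -> t = s.
  case: t s s0 {s_c} => [n [x nx]] [m [y ny]] /= /eqP + /eqP.
  rewrite /dim /= => /eqP m0 /eqP n0; subst n m; congr (Tagged _ _).
  by apply/val_inj; rewrite /= [x]x0P [y]x0P.
move: aug0; rewrite /aug /linext (big_fsetD1 s) //= big1_fset => [|t].
  by rewrite s0 eqxx addr0 /GRing.scale /= mulr1 => /eqP; rewrite mcoeff_eq0 s_c.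
rewrite !inE => /andP[ts _] _; case: eqP => [/eq_s ts0|_]; last by rewrite scaler0.
by rewrite ts0 eqxx in ts.
Qed.

(* The cobar construction as the tensor algebra of the free graded module     *)
(* s^-1 (ker aug), i.e. as the free algebra on its basis, and its tensor      *)
(* square.                                                                    *)
Definition cobar : lalgType k := {malg k[{fmonom cell}]}.

Definition cell_degree (e : cell) : nat := (dim (val e)).-1.

Definition cobar2 : algType k := free2 k cell_degree.

(* c |-> <c>, precomposed with the projection c |-> c - aug(c) x_0 onto ker aug *)
Definition bracket (c : chains) : cobar :=
  linext (fun s => if insub s is Some e then << fmu (e : cell) >> else 0) c.

End NormalizedChains.

Arguments chain k {X n} x.

Section Diagonals.
Variables (k : comNzRingType) (X : sset).

Implicit Type n : nat.

(* the vertices a, a + 1, ..., b *)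
Definition itv (a b : nat) : seq nat := iota a (b.+1 - a)%N.

(* A sequence p_0, p_1, ... is encoded by the list p of its entries; the      *)
(* index 2s - 1 (for s >= 1) is written (2 * s).-1.                           *)
Definition is_cut n (j : nat) (p : seq nat) : bool :=
  [&& sorted leq p, nth 0 p 0 == 0 & nth 0 p (2 * j).+1 == n]%N.

Definition left_face n (x : X n) (p : seq nat) (s : nat) :=
  face x (itv (nth 0 p (2 * s).-1) (nth 0 p (2 * s)))%N.

Definition right_face n (x : X n) (j : nat) (p : seq nat) :=
  face x (flatten [seq itv (nth 0 p (2 * i)) (nth 0 p (2 * i).+1) | i <- iota 0 j.+1])%N.

Definition cut_sign (j : nat) (p : seq nat) : nat :=
  let p_ i := nth 0%N p i in
  (((j * j.-1) %/ 2)
   + \sum_(1 <= s < j.+1) (j.+1 - s) * (p_ (2 * s) - p_ (2 * s).-1)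
   + \sum_(1 <= s < j.+1) p_ (2 * s).-1
   + \sum_(1 <= s < j.+1) (p_ (2 * s) - p_ (2 * s).-1)
       * \sum_(0 <= i < s) (p_ (2 * i).+1 - p_ (2 * i)).+1)%N.

Definition hgc_generator n (x : X n) : cobar2 k X :=
  tens (bracket (chain k x)) 1 +
  \sum_(j < n.+1)
    \sum_(p : (2 * j + 2)%N.-tuple 'I_n.+1 | is_cut n j (map val p))
      (-1) ^+ cut_sign j (map val p) *:
        tens (\prod_(1 <= s < j.+1) bracket (chain k (left_face x (map val p) s)))
             (bracket (chain k (right_face x j (map val p)))).

Definition hgc_diagonal : cobar k X -> cobar2 k X :=
  @multext k (cell X) _ (fun e => hgc_generator (val (tagged (val e)))).

(* Baues' diagonal. A subset b of {1, ..., n - 1} is encoded as a set of      *)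
(* ordinals i < n - 1, where i stands for i + 1.                              *)
Definition shuffle_seq (m : nat) (b : {set 'I_m}) : seq 'I_m := enum (~: b) ++ enum b.

Lemma size_shuffle_seq m (b : {set 'I_m}) : size (shuffle_seq b) = m.
Proof. by rewrite size_cat -!cardE addnC cardsC card_ord. Qed.

Lemma shuffle_seq_uniq m (b : {set 'I_m}) : uniq (shuffle_seq b).
Proof.
rewrite cat_uniq !enum_uniq andbT /=; apply/hasPn => i.
by rewrite !mem_enum inE negbK.
Qed.

Lemma shuffle_inj m (b : {set 'I_m}) : injective (fun i : 'I_m => nth i (shuffle_seq b) i).
Proof.
move=> i j /eqP; rewrite (set_nth_default j) ?size_shuffle_seq //.
by rewrite nth_uniq ?size_shuffle_seq ?shuffle_seq_uniq // => /eqP/val_inj.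
Qed.

Definition shuffle (m : nat) (b : {set 'I_m}) : 'S_m := perm (@shuffle_inj m b).

Definition subset_vertices n (b : {set 'I_n.-1}) : seq nat :=
  [seq (val i).+1 | i <- enum b].

(* <x(v)>, replaced by 1 if v consists of two vertices *)
Definition entry n (x : X n) (v : seq nat) : cobar k X :=
  if size v == 2%N then 1 else bracket (chain k (face x v)).

Definition baues_generator n (x : X n) : cobar2 k X :=
  \sum_(b : {set 'I_n.-1})
    let c := 0%N :: subset_vertices b ++ [:: n] in
    (-1) ^+ shuffle b *:
      tens (\prod_(1 <= i < size c) entry x (itv (nth 0 c i.-1) (nth 0 c i))%N)
           (entry x c).

Definition baues_diagonal : cobar k X -> cobar2 k X :=
  @multext k (cell X) _ (fun e => baues_generator (val (tagged (val e)))).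

End Diagonals.

(* Main.v *)
(* For x in X_n the terms of both diagonals are indexed by the same data: the   *)
(* vertices 0 = c_0 < ... < c_(r+1) = n of Baues' right factor split into       *)
(* maximal runs of consecutive integers [p_0, p_1], [p_2, p_3], ..., and the    *)
(* endpoints of the runs form a cut p with p_(2s) - p_(2s-1) >= 2 for all s.    *)
(* The remaining cuts contribute 0, because X is 1-reduced and hence <y> = 0    *)
(* for y of dimension at most 1. Likewise, the cut (0, 0, n, n) gives 0 on one  *)
(* side, while the corresponding empty subset gives <x> (x) 1 on Baues' side.   *)
(* With d_s = p_(2s) - p_(2s-1) and L_s the number of c_i <= p_(2s-1), the      *)
(* shuffle has sum_s (d_s - 1)(L_s - 1) inversions, and                         *)
(* L_s + sum_(t < s) d_t = p_(2s-1) + s shows that this number is congruent to  *)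
(* epsilon(p) modulo 2.                                                         *)

Require Import Defs.
From mathcomp Require Import all_boot all_fingroup all_algebra zify.
From mathcomp Require Import monalg.

Set Implicit Arguments.
Unset Strict Implicit.
Unset Printing Implicit Defensive.

Import GRing.Theory.

(** Both maps are multiplicative extensions, so it suffices to compare them on a nondegenerate
    simplex of positive dimension n ([generators_eq]). Cutting 0 = c_0 < ... < c_(r+1) = n into
    maximal runs of consecutive integers is a bijection from the subsets of {1, ..., n - 1} onto the
    cuts with all gaps of length at least 2: [runs] and [blocks] invert each other ([blocks_runs],
    [runs_blocks]), and [big_cuts_subsets] transfers sums along this bijection.

    The right factors then have the same vertices. The steps inside a run are edges, which Baues'
    convention omits, so the left factors agree as well ([prod_entry_runs]). Both signs are compared
    with the inversion number of the shuffle: [shuffle_odd] builds the shuffle by adding vertices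
    one at a time, [cut_sign_gap_inversions] builds the exponent by adding gaps one at a time. Cuts
    with a short gap vanish by [bracket_chain_low], and the term at the empty subset is matched
    separately. *)

(** * Cuts and runs of consecutive integers *)

Lemma nth_even_shift a v t s : nth 0 (a :: v :: t) (2 * s.+1) = nth 0 t (2 * s).
Proof. by rewrite mulnS. Qed.

Lemma nth_odd_shift a v t s : 0 < s ->
  nth 0 (a :: v :: t) (2 * s.+1).-1 = nth 0 t (2 * s).-1.
Proof. by case: s => // s _; rewrite !mulnS. Qed.

(** A run occupies two entries of a cut, so inductions strip [a] and [v] together; the first gap
    then lies between [v] and the head of [t]. *)
Lemma big_gaps_cons (T : Type) (idx : T) (op : Monoid.law idx)
    (f : nat -> nat -> T) j a v t :
  \big[op/idx]_(1 <= s < j.+2)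
     f (nth 0 (a :: v :: t) (2 * s).-1) (nth 0 (a :: v :: t) (2 * s)) =
  op (f v (nth 0 t 0))
     (\big[op/idx]_(1 <= s < j.+1) f (nth 0 t (2 * s).-1) (nth 0 t (2 * s))).
Proof.
rewrite big_ltn // big_add1; congr (op _ _); apply: eq_big_nat => s /andP[s0 _].
by rewrite nth_even_shift nth_odd_shift.
Qed.

(** The vertex list underlying [right_face], isolated because it is the inverse of [runs]. *)
Definition blocks (j : nat) (p : seq nat) : seq nat :=
  flatten [seq itv (nth 0 p (2 * i)) (nth 0 p (2 * i).+1) | i <- iota 0 j.+1].

Lemma blocks_cons j a v t : blocks j.+1 (a :: v :: t) = itv a v ++ blocks j t.
Proof.
rewrite /blocks -[iota 0 j.+2]/(0 :: iota 1 j.+1) (iotaDl 1 0) /= -!map_comp.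
congr (_ ++ (_ ++ flatten _)); apply: eq_map => i; rewrite /comp.
by rewrite add1n nth_even_shift mulnS.
Qed.

(* Endpoints of the maximal runs of consecutive integers in a, a + 1, ..., v, t. *)
Fixpoint runs (a v : nat) (t : seq nat) : seq nat :=
  if t is w :: t' then
    if w == v.+1 then runs a w t' else [:: a, v & runs w w t']
  else [:: a; v].

Fixpoint ngaps (v : nat) (t : seq nat) : nat :=
  if t is w :: t' then (w != v.+1) + ngaps w t' else 0.

Definition wide_gaps (j : nat) (p : seq nat) : bool :=
  all (fun s => (nth 0 p (2 * s).-1).+1 < nth 0 p (2 * s)) (iota 1 j).

Lemma wide_gaps_cons j a v t :
  wide_gaps j.+1 (a :: v :: t) = (v.+1 < nth 0 t 0) && wide_gaps j t.
Proof.
set P := fun s => (nth 0 (a :: v :: t) (2 * s).-1).+1 < nth 0 (a :: v :: t) (2 * s).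
rewrite -[LHS]/(P 1 && all P (iota (1 + 1) j)) iotaDl all_map; congr (_ && _).
apply: eq_in_all => s; rewrite mem_iota => /andP[s0 _].
by rewrite -[LHS]/(P s.+1) /P nth_even_shift nth_odd_shift.
Qed.

Lemma size_runs a v t : size (runs a v t) = 2 * ngaps v t + 2.
Proof. by elim: t a v => //= w t IH a v; case: eqP => _ //=; rewrite IH; lia. Qed.

Lemma head_runs a v t : nth 0 (runs a v t) 0 = a.
Proof. by elim: t a v => //= w t IH a v; case: eqP. Qed.

Lemma last_runs a v t : nth 0 (runs a v t) (2 * ngaps v t).+1 = last v t.
Proof.
elim: t a v => //= w t IH a v; case: eqP => _ /=; first exact: IH.
by rewrite -(IH w); congr (nth _ _ _); lia.
Qed.

Lemma runs_sorted a v t : a <= v -> path ltn v t -> sorted leq (runs a v t).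
Proof.
elim: t a v => [|w t IH] a v le_av /=; first by rewrite le_av.
move=> /andP[lt_vw pth]; case: eqP => [_|_]; first by apply: IH => //; lia.
have := head_runs w w t; have := IH w w (leqnn w) pth.
by case: (runs w w t) => [|z u] /=; rewrite ?le_av // => -> ->; rewrite (ltnW lt_vw).
Qed.

Lemma runs_wide a v t : path ltn v t -> wide_gaps (ngaps v t) (runs a v t).
Proof.
elim: t a v => //= w t IH a v /andP[lt_vw pth]; case: eqP => /= [_|ne]; first exact: IH.
by rewrite add1n wide_gaps_cons head_runs IH // andbT; lia.
Qed.

Lemma itv_rcons a v : a <= v.+1 -> itv a v.+1 = itv a v ++ [:: v.+1].
Proof. by move=> le_av; rewrite /itv subSn // -addn1 iotaD /= subnKC. Qed.

Lemma blocks_runs a v t : a <= v -> path ltn v t ->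
  blocks (ngaps v t) (runs a v t) = itv a v ++ t.
Proof.
elim: t a v => [|w t IH] a v le_av //= /andP[lt_vw pth].
case: eqP => [w_v|_] /=.
  by rewrite IH ?w_v ?itv_rcons -?catA //; [lia|lia|rewrite -w_v].
rewrite add1n blocks_cons IH //.
by rewrite {2}/itv subSn // subnn.
Qed.

Lemma runs_iota a v d t : runs a v (iota v.+1 d ++ t) = runs a (v + d) t.
Proof.
elim: d v => [|d IH] v /=; first by rewrite addn0.
by rewrite eqxx IH addSnnS.
Qed.

(** A gap of length 1 would merge two runs and one of length 0 would repeat a vertex. Wide gaps
    exclude both, so the maximal runs of the vertex list are the given ones. *)
Lemma runs_blocks j p : size p = 2 * j + 2 -> sorted leq p -> wide_gaps j p ->
  exists t, [/\ blocks j p = nth 0 p 0 :: t, path ltn (nth 0 p 0) t,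
    last (nth 0 p 0) t = nth 0 p (2 * j).+1 & runs (nth 0 p 0) (nth 0 p 0) t = p].
Proof.
have itvE a v : a <= v -> itv a v = a :: iota a.+1 (v - a).
  by move=> le_av; rewrite /itv subSn.
have lastE a v : a <= v -> last a (iota a.+1 (v - a)) = v.
  move=> le_av; rewrite -[last _ _]/(last a (a :: iota a.+1 (v - a))) -itvE //.
  by rewrite -nth_last /itv size_iota nth_iota; lia.
have pathE a v : path ltn a (iota a.+1 (v - a)).
  exact: (iota_ltn_sorted a (v - a).+1).
elim: j p => [|j IH] [|a [|v p]]; try by move=> /= sz; exfalso; lia.
- case: p => // _ /andP[le_av _] _; exists (iota a.+1 (v - a)); split=> //.
  + by rewrite /blocks /= cats0 itvE.
  + exact: lastE.
  + by rewrite -[iota _ _]cats0 runs_iota subnKC.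
move=> sz /= /andP[le_av pp]; rewrite wide_gaps_cons => /andP[gap wide].
have szp : size p = 2 * j + 2 by move: sz => /=; lia.
have [t [bt pt lt rt]] := IH p szp (path_sorted pp) wide.
exists (iota a.+1 (v - a) ++ nth 0 p 0 :: t); split.
- by rewrite blocks_cons bt itvE.
- by rewrite cat_path pathE lastE //= pt andbT; lia.
- by rewrite last_cat last_cons lt; congr (nth _ _ _); lia.
rewrite runs_iota subnKC //= rt ifF //; lia.
Qed.

(** * The sign of a cut as an inversion number *)

(* Inversions of the shuffle of b, where t lists b followed by n: each vertex   *)
(* skipped between v and the head of t exceeds the l elements of b met so far.  *)
Fixpoint inversions (l v : nat) (t : seq nat) : nat :=
  if t is w :: t' then (w - v).-1 * l + inversions l.+1 w t' else 0.

(** The sum of (d_s - 1)(L_s - 1), with [l] vertices preceding the first run. The last predecessor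
    discounts the vertex 0, which is not an element of b. *)
Definition gap_inversions (l j : nat) (p : seq nat) : nat :=
  \sum_(1 <= s < j.+1) (nth 0 p (2 * s) - nth 0 p (2 * s).-1).-1 *
    (l + \sum_(0 <= i < s) (nth 0 p (2 * i).+1 - nth 0 p (2 * i)).+1).-1.

Lemma gap_inversions_cons l j a v t :
  gap_inversions l j.+1 (a :: v :: t) =
  (nth 0 t 0 - v).-1 * (l + (v - a)) + gap_inversions (l + (v - a).+1) j t.
Proof.
rewrite /gap_inversions big_ltn // big_add1; congr (_ + _).
  by rewrite big_nat1 /= addnS.
apply: eq_big_nat => s /andP[s0 _].
rewrite nth_even_shift nth_odd_shift // big_nat_recl // addnA; congr (_ * (_ + _).-1).
by apply: eq_bigr => i _; rewrite nth_even_shift mulnS.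
Qed.

(** Consecutive vertices skip nothing, so only the gaps contribute. The run from [a] to [v] has one
    vertex more than [v - a]; the discounted vertex 0 makes up for it. *)
Lemma gap_inversions_runs l a v t : a <= v -> path ltn v t ->
  gap_inversions l (ngaps v t) (runs a v t) = inversions (l + (v - a)) v t.
Proof.
elim: t l a v => [|w t IH] l a v le_av /=; first by rewrite /gap_inversions big_geq.
move=> /andP[lt_vw pt]; case: eqP => [w_v|_] /=.
  rewrite IH //; last by lia.
  by rewrite w_v subSnn /= mul0n subSn // addnS.
by rewrite add1n gap_inversions_cons head_runs IH // subnn addn0 addnS.
Qed.

(** Each further gap raises the two exponents by amounts that are congruent modulo 2. *)
Lemma cut_sign_gap_inversions j p : size p = 2 * j + 2 -> sorted leq p ->
  nth 0 p 0 = 0 -> wide_gaps j p -> odd (cut_sign j p) = odd (gap_inversions 0 j p).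
Proof.
move=> sz srt p0 wide; rewrite /cut_sign /gap_inversions.
have p_le i : i < 2 * j + 1 -> nth 0 p i <= nth 0 p i.+1.
  by move=> lt_i; apply: (sorted_leq_nth leq_trans leqnn 0 srt); rewrite ?inE ?sz //; lia.
have gap s : 0 < s <= j -> (nth 0 p (2 * s).-1).+1 < nth 0 p (2 * s).
  by move=> s_j; apply: (allP wide); rewrite mem_iota; lia.
pose d s := nth 0 p (2 * s) - nth 0 p (2 * s).-1.
pose L s := \sum_(0 <= i < s) (nth 0 p (2 * i).+1 - nth 0 p (2 * i)).+1.
(* Each integer from 0 to p_(2s+1) lies in one of the first s + 1 runs or is one of the d_t - 1
   interior points of a gap t <= s. *)
have vertex_count s : s <= j ->
    nth 0 p (2 * s).+1 + s.+1 = L s.+1 + \sum_(1 <= t < s.+1) d t.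
  elim: s => [_|s IH s_j]; first by rewrite /L big_nat1 big_geq // p0; lia.
  rewrite [L s.+2]big_nat_recr // -/(L s.+1) [\sum_(1 <= t < s.+2) _]big_nat_recr //=.
  have dS : d s.+1 = nth 0 p (2 * s).+2 - nth 0 p (2 * s).+1 by rewrite /d mulnS.
  have := IH (ltnW s_j); have := p_le (2 * s).+1; have := p_le (2 * s).+2.
  rewrite (_ : 2 * s.+1 = (2 * s).+2) /=; last by lia.
  by move=> *; lia.
(* The cut [p] stays fixed; only its first [i] gaps are counted. *)
suff: forall i, i <= j -> odd ((i * i.-1) %/ 2 + \sum_(1 <= s < i.+1) (i.+1 - s) * d s
   + \sum_(1 <= s < i.+1) nth 0 p (2 * s).-1 + \sum_(1 <= s < i.+1) d s * L s) =
   odd (\sum_(1 <= s < i.+1) (d s).-1 * (0 + L s).-1) by apply.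
elim=> [_|i IH i_j]; first by rewrite !big_geq.
have half_step : (i.+1 * i.+1.-1) %/ 2 = (i * i.-1) %/ 2 + i.
  rewrite (_ : i.+1 * _ = i * 2 + i * i.-1) ?divnMDl // 1?addnC //.
  by case: (i) => //= m; rewrite !mulSn mulnS; lia.
have weight_step : \sum_(1 <= s < i.+2) (i.+2 - s) * d s =
    \sum_(1 <= s < i.+1) (i.+1 - s) * d s + \sum_(1 <= s < i.+1) d s + d i.+1.
  rewrite big_nat_recr // subSnn mul1n -big_split /=; congr (_ + _).
  by apply: eq_big_nat => s s_i; rewrite subSn ?mulSn 1?addnC //; lia.
rewrite weight_step half_step ![\sum_(1 <= s < i.+2) _]big_nat_recr //.
have := IH (ltnW i_j); have := vertex_count i (ltnW i_j); have := gap i.+1 i_j.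
rewrite (_ : (2 * i.+1).-1 = (2 * i).+1); last by lia.
rewrite add0n.
have : 0 < d i.+1 by have := gap i.+1 i_j; rewrite /d; lia.
have : 0 < L i.+1 by rewrite /L big_nat_recl.
move: (d i.+1) (L i.+1) (nth 0 p _.+1) => [//|d'] [//|l] q _ _ _.
set A := _ %/ 2; set B := bigop.body _ _ _; move=> qE IHi.
set C := bigop.body _ _ _ in IHi *; set D := bigop.body _ _ _ in IHi *.
set E := bigop.body _ _ _ in IHi *.
(* [B] is the sum of the first [i] gap lengths, and [qE] says that [i + q] equals [l + B]. Hence the
   increment on the left is [d' * l] plus an even number. *)
have -> : A + i + (C + B + d'.+1) + (D + q) + (E + d'.+1 * l.+1) =
    (A + C + D + E) + (d' * l + (l + B + d' + 1) * 2).
  by rewrite mulSn mulnS; lia.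
by rewrite oddD IHi [odd (d' * l + _)]oddD [odd (_ * 2)]oddM andbF addbF -oddD.
Qed.

(** * The parity of a shuffle *)

(** [inversions] recurses from the left, whereas the shuffle is built up at its largest vertex. *)
Lemma inversions_rcons l v t w : inversions l v (rcons t w) =
  inversions l v t + (w - last v t).-1 * (l + size t).
Proof.
elim: t l v => [|u t IH] l v /=; first by rewrite !addn0.
by rewrite IH addnA addSnnS.
Qed.

(** One-line notation of the shuffle. A predicate on [nat], unlike a set of ordinals, makes sense
    for all [m] at once, as induction on [m] requires. *)
Definition shuffle_list (m : nat) (P : pred nat) : seq nat :=
  filter (predC P) (iota 0 m) ++ filter P (iota 0 m).

Definition vertex_list (m : nat) (P : pred nat) : seq nat :=
  map S (filter P (iota 0 m)).

Lemma iota_rcons m : iota 0 m.+1 = rcons (iota 0 m) m.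
Proof. by rewrite -addn1 iotaD cats1. Qed.

Lemma shuffle_listS m P : shuffle_list m.+1 P =
  let i0 := if P m then m else count (predC P) (iota 0 m) in
  take i0 (shuffle_list m P) ++ m :: drop i0 (shuffle_list m P).
Proof.
have sz : size (shuffle_list m P) = m.
  by rewrite size_cat !size_filter addnC count_predC size_iota.
rewrite /shuffle_list iota_rcons !filter_rcons [predC P m]/= -/(shuffle_list m P).
case: (P m) => /=.
  by rewrite take_oversize ?drop_oversize ?sz // -rcons_cat cats1.
by rewrite -size_filter take_size_cat // drop_size_cat // cat_rcons.
Qed.

Lemma map_val_enum m (b : {set 'I_m}) (P : pred nat) :
  (forall i : 'I_m, (i \in b) = P i) -> map val (enum b) = filter P (iota 0 m).
Proof.
move=> bP; rewrite -val_enum_ord filter_map enumT; congr map.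
by apply: eq_filter => i; rewrite /= -bP.
Qed.

Lemma shuffleE m (b : {set 'I_m}) (P : pred nat) (i : 'I_m) :
  (forall i : 'I_m, (i \in b) = P i) -> shuffle b i = nth 0 (shuffle_list m P) i :> nat.
Proof.
move=> bP; rewrite permE -(nth_map i 0 val) ?size_shuffle_seq //.
rewrite map_cat (map_val_enum bP) (@map_val_enum _ (~: b) (predC P)) // => j.
by rewrite inE bP.
Qed.

(** Removing the largest value [m], which stands at position [i0], changes the parity by [m - i0].
    This is 0 if [m] is in the subset; otherwise it counts the elements of the subset below [m], all
    of which are listed after [m]. *)
Lemma shuffle_list_odd m (P : pred nat) (s : 'S_m) :
  (forall i, s i = nth 0 (shuffle_list m P) i :> nat) ->
  odd_perm s = odd (inversions 0 0 (rcons (vertex_list m P) m.+1)).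
Proof.
elim: m s => [|m IH] s sE.
  by rewrite (_ : s = 1%g) ?odd_perm1 //; apply/permP=> -[].
pose s' := shuffle [set i : 'I_m | P i].
have s'E i : s' i = nth 0 (shuffle_list m P) i :> nat by apply: shuffleE => j; rewrite inE.
pose n0 := if P m then m else count (predC P) (iota 0 m).
have n0m : n0 <= m.
  by rewrite /n0; case: ifP => // _; rewrite -[leqRHS](size_iota 0) count_size.
have sz : size (shuffle_list m P) = m.
  by rewrite size_cat !size_filter addnC count_predC size_iota.
have szt : size (take n0 (shuffle_list m P)) = n0 by rewrite size_takel // sz.
pose i0 : 'I_m.+1 := Ordinal (n0m : n0 < m.+1).
have -> : s = lift_perm i0 ord_max s'.
  apply/permP=> i; apply/val_inj; rewrite /= sE shuffle_listS -/n0 /=.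
  case: (unliftP i0 i) => [j ->|->].
    rewrite lift_perm_lift /= nth_cat szt.
    have -> : bump m (s' j) = s' j by rewrite /bump leqNgt ltn_ord.
    rewrite s'E.
    rewrite /bump /=; case: (leqP n0 j) => le_j; last by rewrite add0n le_j nth_take.
    by rewrite add1n ltnNge leqW //= subSn //= nth_drop subnKC.
  by rewrite lift_perm_id /= nth_cat szt ltnn subnn.
rewrite odd_lift_perm (IH _ s'E) /= /n0.
have vertex_listS : vertex_list m.+1 P =
    if P m then rcons (vertex_list m P) m.+1 else vertex_list m P.
  by rewrite /vertex_list iota_rcons filter_rcons; case: ifP => //; rewrite map_rcons.
rewrite vertex_listS [in RHS]inversions_rcons; case: ifP => Pm.
  (* The final entry directly follows the vertex [m.+1], so nothing is skipped between them. *)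
  by rewrite addbb last_rcons subSnn /= addn0.
have last_le : last 0 (vertex_list m P) <= m.
  have: last 0 (vertex_list m P) \in 0 :: vertex_list m P by exact: mem_last.
  rewrite inE => /orP[/eqP->//|/mapP[i]].
  by rewrite mem_filter mem_iota => /andP[_ /andP[_ lt_im]] ->.
rewrite !inversions_rcons !subSn ?leqW //= add0n mulSn addnA addnAC [in RHS]oddD addbC.
congr (_ (+) _); rewrite size_map size_filter -oddD.
have := count_predC P (iota 0 m); rewrite size_iota => mE.
(* [m] splits into the sizes of the subset and of its complement; the latter is also the position of
   [m], so it occurs twice and cancels. *)
by rewrite -[X in odd (_ + X)]mE addnCA addnn oddD odd_double addbF.
Qed.

Lemma shuffle_odd m (b : {set 'I_m}) (P : pred nat) :
  (forall i : 'I_m, (i \in b) = P i) ->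
  odd_perm (shuffle b) = odd (inversions 0 0 (rcons (vertex_list m P) m.+1)).
Proof. by move=> bP; apply: shuffle_list_odd => i; apply: shuffleE. Qed.

(** * Subsets of vertices and their cuts *)

Lemma vertex_list_path m P : path ltn 0 (rcons (vertex_list m P) m.+1).
Proof.
apply: (subseq_path ltn_trans (s2 := iota 1 m.+1)); last exact: (iota_ltn_sorted 0 m.+2).
rewrite (_ : iota 1 m.+1 = rcons (map S (iota 0 m)) m.+1).
  by rewrite -!cats1 cat_subseq // map_subseq // filter_subseq.
by rewrite -map_rcons -iota_rcons -(iotaDl 1 0).
Qed.

Lemma subset_verticesE m (b : {set 'I_m}) (P : pred nat) :
  (forall i : 'I_m, (i \in b) = P i) -> @subset_vertices m.+1 b = vertex_list m P.
Proof.
by move=> bP; rewrite /vertex_list -(map_val_enum bP) -map_comp.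
Qed.

Definition subset_pred m (b : {set 'I_m}) (i : nat) : bool :=
  if insub i is Some j then j \in b else false.

Lemma subset_predE m (b : {set 'I_m}) (i : 'I_m) : (i \in b) = subset_pred b i.
Proof. by rewrite /subset_pred valK. Qed.

(** The vertices of Baues' right factor without the leading 0, which enters as the starting run of
    [runs 0 0]. *)
Definition subset_tail m (b : {set 'I_m}) : seq nat :=
  rcons (@subset_vertices m.+1 b) m.+1.

Lemma subset_tail_path m (b : {set 'I_m}) : path ltn 0 (subset_tail b).
Proof. by rewrite /subset_tail (subset_verticesE (subset_predE b)) vertex_list_path. Qed.

Lemma subset_tail_last m (b : {set 'I_m}) : last 0 (subset_tail b) = m.+1.
Proof. by rewrite last_rcons. Qed.

Lemma subset_tail_inj m : injective (@subset_tail m).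
Proof.
move=> b c /rcons_inj[eq_bc]; apply/setP => i.
have memE (a : {set 'I_m}) : (i \in a) = (i.+1 \in @subset_vertices m.+1 a).
  rewrite /subset_vertices (mem_map (f := fun i : 'I_m => (val i).+1)) ?mem_enum //.
  by move=> j l [/val_inj].
by rewrite !memE eq_bc.
Qed.

Lemma subset_tail_surj m t : path ltn 0 t -> last 0 t = m.+1 ->
  exists b : {set 'I_m}, subset_tail b = t.
Proof.
case/lastP: t => // t n pt; rewrite last_rcons => n_m; rewrite {n}n_m in pt *.
exists [set i : 'I_m | i.+1 \in t].
rewrite /subset_tail (@subset_verticesE _ _ (fun i => i.+1 \in t)); last first.
  by move=> i; rewrite inE.
congr rcons; move: (vertex_list_path m (fun i => i.+1 \in t)) pt.
rewrite !rcons_path => /andP[/path_sorted pv _] /andP[pt lt_last].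
apply: (irr_sorted_eq ltn_trans ltnn pv (path_sorted pt)) => i.
apply/mapP/idP => [[j + ->]|it]; first by rewrite mem_filter => /andP[].
have all_pos := order_path_min ltn_trans pt.
have i0 : 0 < i by apply: (allP all_pos).
exists i.-1; last by rewrite prednK.
rewrite mem_filter /= prednK // it mem_iota /=.
suff : i <= last 0 t by lia.
have [k kt <-] := (nthP 0 it); rewrite (last_nth 0) -[nth 0 t k]/(nth 0 (0 :: t) k.+1).
have st : sorted leq (0 :: t) by apply: sub_path pt => x y; apply: ltnW.
by apply: (sorted_leq_nth leq_trans leqnn 0 st); rewrite ?inE /=.
Qed.

Definition subset_cut m (b : {set 'I_m}) : seq nat := runs 0 0 (subset_tail b).

Definition gap_count m (b : {set 'I_m}) : nat := ngaps 0 (subset_tail b).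

Lemma runs_bounded a v t : a <= v -> path ltn v t ->
  all (fun i => i <= last v t) (runs a v t).
Proof.
move=> le_av pt; apply/allP => i /(nthP 0)[k kt <-].
rewrite -(last_runs a); apply: (sorted_leq_nth leq_trans leqnn 0 (runs_sorted le_av pt)).
- exact: kt.
- by rewrite inE size_runs; lia.
- by move: kt; rewrite size_runs; lia.
Qed.

(** A gap skips at least one vertex and so has length at least 2. Hence the number of gaps stays
    within the range of [j] in the sum over cuts. *)
Lemma ngaps_le v t : path ltn v t -> 2 * ngaps v t <= last v t - v.
Proof.
have path_le : forall t v, path ltn v t -> v <= last v t.
  by elim=> //= {}t u IH w /andP[lt_wu /IH]; lia.
elim: t v => //= w t IH v /andP[lt_vw pt].
by have := IH w pt; have := path_le _ _ pt; case: eqP => /=; lia.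
Qed.

(** Both parities are that of [inversions 0 0 (subset_tail b)]. *)
Lemma subset_cut_sign m (b : {set 'I_m}) :
  odd (cut_sign (gap_count b) (subset_cut b)) = odd_perm (shuffle b).
Proof.
have pb := subset_tail_path b.
rewrite cut_sign_gap_inversions ?size_runs ?runs_sorted ?head_runs ?runs_wide //.
rewrite gap_inversions_runs // (shuffle_odd (subset_predE b)).
by rewrite /subset_tail (subset_verticesE (subset_predE b)).
Qed.

(** * Transfer of products and sums between cuts and subsets *)

Local Open Scope ring_scope.

(** Steps from [u] to [u.+1] contribute 1, and the remaining steps are the gaps. The start [a] of
    the first run bounds no gap, so it is arbitrary. *)
Lemma prod_consecutive_runs (R : pzRingType) (f : nat -> nat -> R) a v t :
  (forall u, f u u.+1 = 1) ->
  \prod_(1 <= i < size (v :: t)) f (nth 0%N (v :: t) i.-1) (nth 0%N (v :: t) i) =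
  \prod_(1 <= s < (ngaps v t).+1)
    f (nth 0%N (runs a v t) (2 * s).-1) (nth 0%N (runs a v t) (2 * s)).
Proof.
move=> f1; elim: t a v => [|w t IH] a v; first by rewrite !big_geq.
rewrite big_ltn // big_add1.
rewrite (_ : \prod_(1 <= i < _) _ =
    \prod_(1 <= i < size (w :: t)) f (nth 0%N (w :: t) i.-1) (nth 0%N (w :: t) i)); last first.
  by apply: eq_big_nat => -[].
rewrite -[nth 0%N _ 0]/v -[nth 0%N _ 1]/w [runs a v _]/= [ngaps v _]/=.
case: eqP => [->|_] /=; first by rewrite f1 mul1r (IH a).
by rewrite (IH w) add1n big_gaps_cons head_runs.
Qed.

(** Each wide cut comes from exactly one subset, and each subset yields one cut for one [j]; the
    double sum over matching pairs is evaluated in both orders. *)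
Lemma big_cuts_subsets (V : nmodType) m (F : nat -> seq nat -> V) :
  \sum_(j < m.+2) \sum_(p : (2 * j + 2)%N.-tuple 'I_m.+2
      | is_cut m.+1 j (map val p) && wide_gaps j (map val p)) F j (map val p) =
  \sum_(b : {set 'I_m}) F (gap_count b) (subset_cut b).
Proof.
transitivity (\sum_(j < m.+2) \sum_(p : (2 * j + 2)%N.-tuple 'I_m.+2
      | is_cut m.+1 j (map val p) && wide_gaps j (map val p))
   \sum_(b : {set 'I_m} | subset_cut b == map val p) F (gap_count b) (subset_cut b)).
  apply: eq_bigr => j _; apply: eq_bigr => p /andP[/and3P[srt /eqP p0 /eqP pn] wide].
  have sz : size (map val p) = (2 * j + 2)%N by rewrite size_map size_tuple.
  have [t [bt pt lt rt]] := runs_blocks sz srt wide.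
  rewrite p0 in bt pt lt rt; rewrite pn in lt.
  have [b bE] := subset_tail_surj pt lt.
  have pE : subset_cut b = map val p by rewrite /subset_cut bE.
  have jE : gap_count b = j.
    by have := size_runs 0 0 t; rewrite rt sz /gap_count bE; lia.
  rewrite (big_pred1 b) ?pE ?jE // => c /=; rewrite -pE.
  apply/eqP/eqP => [eq_cb|->//]; apply: subset_tail_inj.
  (* [blocks] recovers a subset from its cut. *)
  have blocksE (a : {set 'I_m}) : blocks (gap_count a) (subset_cut a) = 0%N :: subset_tail a.
    by rewrite blocks_runs ?subset_tail_path.
  suff [//] : 0%N :: subset_tail c = 0%N :: subset_tail b.
  rewrite -!blocksE eq_cb; congr (blocks _ _).
  have := congr1 size eq_cb; rewrite !size_runs /gap_count; lia.
under eq_bigr do rewrite (exchange_big_dep predT) //=.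
rewrite exchange_big; apply: eq_bigr => b _ /=.
have pb := subset_tail_path b; have lb := subset_tail_last b.
have j_lt : (gap_count b < m.+2)%N by have := ngaps_le pb; rewrite lb /gap_count; lia.
rewrite (bigD1 (Ordinal j_lt)) //= [X in _ + X]big1 ?addr0; last first.
  move=> j ne_j; rewrite big_pred0 // => p; apply/negbTE; rewrite negb_and orbC.
  apply/orP; left; apply: contra ne_j => /eqP/(congr1 size).
  rewrite size_runs size_map size_tuple => eq_sz.
  by apply/eqP/val_inj; rewrite /= /gap_count; lia.
have szb : size (map inord (subset_cut b) : seq 'I_m.+2) == (2 * gap_count b + 2)%N.
  by rewrite size_map size_runs.
have valb : map val (map inord (subset_cut b) : seq 'I_m.+2) = subset_cut b.
  rewrite -map_comp map_id_in // => i ib /=; rewrite inordK //.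
  by have /allP/(_ i ib) := runs_bounded (leqnn 0) pb; rewrite lb; lia.
rewrite (big_pred1 (Tuple szb)) // => p /=; apply/andP/eqP => [[_ /eqP pE]|->].
  by apply/val_inj/(inj_map val_inj); rewrite /= valb.
rewrite /= valb; split=> //; rewrite /is_cut runs_sorted // head_runs last_runs lb.
by rewrite !eqxx runs_wide.
Qed.

(** Here [c] is to be <x> (x) 1: an extra summand on one side, the term at the empty subset on the
    other. *)
Lemma addr_sum_eq_set0 (V : nmodType) m (F G : {set 'I_m} -> V) c :
    F set0 = 0 -> G set0 = c -> (forall b, b != set0 -> F b = G b) ->
  c + \sum_b F b = \sum_b G b.
Proof.
move=> F0 G0 FG; rewrite (bigD1 set0) // [RHS](bigD1 set0) //= F0 G0 add0r.
by congr (_ + _); apply: eq_bigr.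
Qed.

(** * Comparison on generators *)

Section Generators.
Variables (k : comNzRingType) (X : sset).
Hypothesis hX : one_reduced X.

(** [bracket] discards 0-simplices, and every 1-simplex is degenerate. *)
Lemma bracket_chain_low d (y : X d) : (d <= 1)%N -> bracket (chain k y) = 0.
Proof.
move=> d1; rewrite /chain; case: insubP => [u nd _|_]; last exact: linear0.
rewrite /bracket linextU; case: insubP => // e pos _.
case: d d1 y u nd pos => [|[|d]] // _ y u nd _; last by rewrite hX.2 in nd.
Qed.

Lemma tens0l (b : cobar k X) : tens 0 b = 0 :> cobar2 k X.
Proof. by rewrite tens.unlock linear0. Qed.

Lemma tens0r (a : cobar k X) : tens a 0 = 0 :> cobar2 k X.
Proof.
rewrite tens.unlock /linext big1 // => v _.
by rewrite -/(linext _ _) linear0 scaler0.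
Qed.

(** The dimension of a face equals [n] only propositionally. Passing to chains, whose type does not
    mention the dimension, avoids a transport. *)
Lemma chain_vertex_id d n (x : X n) (v : nat -> nat) : d = n ->
  (forall i, (i <= n)%N -> v i = i) -> chain k (sact (vertex_op d n v) x) = chain k x.
Proof.
move=> -> vE; suff -> : vertex_op n n v = simp_op_id n by rewrite sact_id.
apply/val_inj/ffunP => i; apply/val_inj; rewrite /= vertex_opE ?ffunE.
- by rewrite vE // -ltnS.
- by move=> a b /andP[le_ab le_bn]; rewrite !vE // (leq_trans le_ab).
- by move=> a le_an; rewrite vE.
Qed.

Lemma chain_face_itv n (x : X n) : chain k (face x (itv 0 n)) = chain k x.
Proof.
apply: chain_vertex_id; first by rewrite size_iota subn0.
by move=> i le_in; rewrite nth_iota ?add0n // subn0.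
Qed.

(** A gap of length at most 1 yields a factor of dimension at most 1, which is 0. *)
Lemma prod_left_face_eq0 n (x : X n) j p : ~~ wide_gaps j p ->
  \prod_(1 <= s < j.+1) bracket (chain k (left_face x p s)) = 0.
Proof.
case/allPn => s; rewrite /index_iota subn1 /= => + small.
elim: (iota 1 j) => //= u l IH; rewrite big_cons inE => /orP[/eqP <-|/IH ->].
  rewrite [X in X * _]bracket_chain_low ?mul0r // size_iota.
  by move: small; rewrite -leqNgt; lia.
exact: mulr0.
Qed.

Definition hgc_term n (x : X n) j p : cobar2 k X :=
  (-1) ^+ cut_sign j p *:
    tens (\prod_(1 <= s < j.+1) bracket (chain k (left_face x p s)))
         (bracket (chain k (right_face x j p))).

Lemma hgc_generator_wide n (x : X n) :
  hgc_generator k x = tens (bracket (chain k x)) 1 +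
    \sum_(j < n.+1) \sum_(p : (2 * j + 2)%N.-tuple 'I_n.+1
       | is_cut n j (map val p) && wide_gaps j (map val p)) hgc_term x j (map val p).
Proof.
congr (_ + _); apply: eq_bigr => j _.
rewrite [RHS]big_mkcondr; apply: eq_bigr => p _; case: ifPn => // wide.
by rewrite prod_left_face_eq0 // tens0l scaler0.
Qed.

(** A wide gap spans at least three vertices, so its entry is a genuine bracket and not replaced by
    1. *)
Lemma prod_entry_runs n (x : X n) t : path ltn 0%N t ->
  \prod_(1 <= i < size (0%N :: t))
     entry k x (itv (nth 0 (0 :: t) i.-1) (nth 0 (0 :: t) i))%N =
  \prod_(1 <= s < (ngaps 0 t).+1) bracket (chain k (left_face x (runs 0 0 t) s)).
Proof.
move=> pt.
rewrite (@prod_consecutive_runs _ (fun v w => entry k x (itv v w)) 0%N); last first.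
  by move=> u; rewrite /entry ifT // size_iota subSn // subSnn.
apply: eq_big_nat => s s_j; rewrite /entry ifF //.
have /allP/(_ s) := runs_wide 0 pt; rewrite mem_iota size_iota add1n => /(_ s_j).
by lia.
Qed.

Lemma generators_eq n (x : X n) : (0 < n)%N -> ~~ degenerate x ->
  hgc_generator k x = baues_generator k x.
Proof.
case: n x => // m x _ nd.
have m0 : (0 < m)%N by case: m x nd => // x; rewrite hX.2.
pose prods (b : {set 'I_m}) : cobar k X :=
  \prod_(1 <= i < size (0%N :: subset_tail b))
     entry k x (itv (nth 0 (0 :: subset_tail b) i.-1) (nth 0 (0 :: subset_tail b) i))%N.
pose baues_term b : cobar2 k X :=
  (-1) ^+ shuffle b *: tens (prods b) (entry k x (0%N :: subset_tail b)).
have bauesE : baues_generator k x = \sum_(b : {set 'I_m}) baues_term b.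
  by apply: eq_bigr => b _; rewrite /baues_term /prods /subset_tail -cats1.
(* The right factor is kept as a bracket, which differs from [entry] precisely for empty [b]. *)
have termE (b : {set 'I_m}) : hgc_term x (gap_count b) (subset_cut b) =
    (-1) ^+ shuffle b *: tens (prods b) (bracket (chain k (face x (0%N :: subset_tail b)))).
  have pb := subset_tail_path b.
  have signE : (-1) ^+ cut_sign (gap_count b) (subset_cut b) = (-1) ^+ shuffle b :> k.
    by rewrite -signr_odd subset_cut_sign.
  have blocksE : blocks (gap_count b) (subset_cut b) = 0%N :: subset_tail b.
    by rewrite blocks_runs.
  have rightE : bracket (chain k (right_face x (gap_count b) (subset_cut b))) =
      bracket (chain k (face x (0%N :: subset_tail b))).
    by rewrite -blocksE.
  by rewrite /prods (prod_entry_runs x pb) /hgc_term signE rightE.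
have set0_tail : subset_tail (@set0 'I_m) = [:: m.+1].
  by rewrite /subset_tail /subset_vertices enum_set0.
(* On the edge from 0 to [m.+1] the bracket is 0, while [entry] is 1. *)
have hgc0 : hgc_term x (gap_count (@set0 'I_m)) (subset_cut (@set0 'I_m)) = 0.
  have edge0 : bracket (chain k (face x [:: 0; m.+1]%N)) = 0 by apply: bracket_chain_low.
  rewrite (termE set0) set0_tail edge0 tens0r; exact: scaler0.
have baues0 : baues_term set0 = tens (bracket (chain k x)) 1.
  have sign0 : odd_perm (shuffle (@set0 'I_m)) = false.
    rewrite (@shuffle_odd _ _ pred0) => [|i]; last by rewrite inE.
    by rewrite /vertex_list filter_pred0 /= muln0.
  have entry_itv : entry k x (itv 0 m.+1) = bracket (chain k x).
    have size_ne2 : (size (itv 0 m.+1) == 2%N) = false by rewrite size_iota; lia.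
    by rewrite /entry size_ne2 chain_face_itv.
  have prods0 : prods set0 = bracket (chain k x).
    by rewrite /prods set0_tail big_nat1 -entry_itv.
  rewrite /baues_term prods0 sign0 set0_tail; exact: scale1r.
have termsE b : b != set0 -> hgc_term x (gap_count b) (subset_cut b) = baues_term b.
  (* A nonempty [b] leaves at least three vertices in the right factor. *)
  move=> b0; rewrite termE /baues_term /entry ifF; first by [].
  by rewrite /= size_rcons size_map -cardE !eqSS cards_eq0 (negbTE b0).
rewrite hgc_generator_wide big_cuts_subsets bauesE.
exact: (addr_sum_eq_set0 hgc0 baues0 termsE).
Qed.

End Generators.

Theorem propositionA1 (k : comNzRingType) (X : sset) (hX : one_reduced X)
    (a : cobar k X) :
  hgc_diagonal a = baues_diagonal a.
Proof.
rewrite /hgc_diagonal /baues_diagonal /multext /linext.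
apply: eq_bigr => w _; congr (_ *: _); apply: eq_bigr => e _.
exact: generators_eq (valP e) (valP (tagged (val e))).
Qed.
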